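(* Let $R$ be a commutative noetherian ring and let $\mathcal{X}$ be an additive subcategory of $\mathsf{mod}\,R$ closed under direct summands. Then the following are equivalent. (1) $\mathcal{X}$ is closed under extensions (resp. closed under kernels, KE-closed) in $\mathsf{mod}\,R$. (2) $\mathcal{X}_{\mathfrak p}$ is closed under extensions (resp. closed under kernels, KE-closed) in $\mathsf{mod}\,R_{\mathfrak p}$ for all $\mathfrak p\in\operatorname{Spec}R$. (3) $\mathcal{X}_{\mathfrak m}$ is closed under extensions (resp. closed under kernels, KE-closed) in $\mathsf{mod}\,R_{\mathfrak m}$ for all maximal ideals $\mathfrak m$ of $R$.
   Context: $\mathsf{mod}\,R$ is the category of finitely generated $R$-modules. All subcategories are full and closed under isomorphisms; additive means closed under finite direct sums (so containing $0$). An additive subcategory is closed under extensions if the middle term of every short exact sequence whose outer terms lie in it also lies in it; closed under kernels if it contains the kernel of every morphism between its objects; KE-closed if both hold. For a prime $\mathfrak p$, $\mathcal{X}_{\mathfrak p}$ is the subcategory $\{M_{\mathfrak p}\mid M\in\mathcal{X}\}$ of $\mathsf{mod}\,R_{\mathfrak p}$ (up to isomorphism). *)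

(* Defs.v *)
From HB Require Import structures.
From mathcomp Require Import all_boot all_algebra.
From mathcomp Require Import boolp.
From mathcomp Require Import ring.

Set Implicit Arguments.
Unset Strict Implicit.
Unset Printing Implicit Defensive.

Import GRing.Theory.
Local Open Scope ring_scope.
Local Open Scope quotient_scope.

Section Localization.
Variables (R : comPzRingType) (S : mulrClosed R).

Definition den : Type := {s : R | s \in S}.

Definition den1 : den := exist _ 1 (rpred1 S).
Definition denM (s t : den) : den :=
  exist _ (sval s * sval t) (rpredM (svalP s) (svalP t)).

Section Module.
Variable M : lmodType R.
Implicit Types (m n : M) (s t : den).

(* Zero divisors are allowed: m/s = n/t iff u(tm) = u(sn) for some u in S. *)
Definition frac_rel : rel (M * {s : R | s \in S}) := fun x y =>
  `[< exists2 u, u \in S & u *: (sval y.2 *: x.1) = u *: (sval x.2 *: y.1) >].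

Lemma frac_rel_refl : reflexive frac_rel.
Proof. by move=> x; apply/asboolP; exists 1; rewrite ?rpred1. Qed.

Lemma frac_rel_sym : symmetric frac_rel.
Proof.
move=> x y; apply/asboolP/asboolP => -[u Su e]; by exists u.
Qed.

Lemma frac_rel_trans : transitive frac_rel.
Proof.
move=> [n [t St]] [m [s Ss]] [k [w Sw]] /asboolP[u Su /= e] /asboolP[v Sv /= f].
apply/asboolP; exists (u * v * t) => /=; first by rewrite !rpredM.
have {e}e := congr1 (fun z : M => (v * w) *: z) e.
have {f}f := congr1 (fun z : M => (u * s) *: z) f.
move: e f; rewrite !scalerA => e f.
transitivity ((v * w * u * t) *: m); first by congr (_ *: _); ring.
transitivity ((u * s * v * w) *: n); last by rewrite f; congr (_ *: _); ring.
by rewrite e; congr (_ *: _); ring.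
Qed.

Canonical frac_equiv := EquivRel frac_rel frac_rel_refl frac_rel_sym frac_rel_trans.

End Module.

Definition loc (M : lmodType R) : Type := {eq_quot @frac_equiv M}.
HB.instance Definition _ M := Choice.on (loc M).

(* The ring S^-1 R is carried by the localization of the regular module; its
   product is the scalar action (a/s)(m/t) = (am)/(st) taken on R^o. *)
Definition locr : Type := loc R^o.
HB.instance Definition _ := Choice.on locr.

Section ModuleTheory.
Variable M : lmodType R.
Implicit Types (m n : M) (s t : den) (x y z : loc M).

Definition frac m s : loc M := \pi_({eq_quot @frac_equiv M}) (m, s).

Lemma frac_eq m n s t :
  frac m s = frac n t <->
  exists2 u, u \in S & u *: (sval t *: m) = u *: (sval s *: n).
Proof.
split; first by move/eqmodP/asboolP.
by move=> h; apply/eqmodP/asboolP.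
Qed.

Lemma frac_surj x : {ms : M * den | x = frac ms.1 ms.2}.
Proof.
exists (repr (x : {eq_quot @frac_equiv M})).
by rewrite /frac -surjective_pairing reprK.
Qed.

Definition loc_num x : M := (sval (frac_surj x)).1.
Definition loc_den x : den := (sval (frac_surj x)).2.

Lemma loc_numden x : frac (loc_num x) (loc_den x) = x.
Proof. by rewrite -(svalP (frac_surj x)). Qed.

Lemma frac_ind (P : loc M -> Prop) : (forall m s, P (frac m s)) -> forall x, P x.
Proof. by move=> h x; rewrite -(loc_numden x). Qed.

Definition loc_add x y : loc M :=
  frac (sval (loc_den y) *: loc_num x + sval (loc_den x) *: loc_num y)
       (denM (loc_den x) (loc_den y)).
Definition loc_opp x : loc M := frac (- loc_num x) (loc_den x).
Definition loc_zero : loc M := frac 0 den1.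

Lemma loc_addE m n s t :
  loc_add (frac m s) (frac n t) = frac (sval t *: m + sval s *: n) (denM s t).
Proof.
rewrite /loc_add; move: (loc_numden (frac m s)) (loc_numden (frac n t)).
move: (loc_num (frac m s)) (loc_den (frac m s)) => m' s'.
move: (loc_num (frac n t)) (loc_den (frac n t)) => n' t'.
move=> /frac_eq[u Su e] /frac_eq[v Sv f].
apply/frac_eq; exists (u * v); first by rewrite rpredM.
have {e}e := congr1 (fun z : M => (v * sval t * sval t') *: z) e.
have {f}f := congr1 (fun z : M => (u * sval s * sval s') *: z) f.
move: e f; rewrite /= !scalerDr !scalerA => e f; congr (_ + _).
- transitivity ((v * sval t * sval t' * u * sval s) *: m').
    by congr (_ *: _); ring.
  by rewrite e; congr (_ *: _); ring.
- transitivity ((u * sval s * sval s' * v * sval t) *: n').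
    by congr (_ *: _); ring.
  by rewrite f; congr (_ *: _); ring.
Qed.

Lemma loc_oppE m s : loc_opp (frac m s) = frac (- m) s.
Proof.
rewrite /loc_opp; move: (loc_numden (frac m s)).
move: (loc_num _) (loc_den _) => m' s' /frac_eq[u Su e].
by apply/frac_eq; exists u; rewrite // !scalerN e.
Qed.

Lemma loc_addA : associative loc_add.
Proof.
elim/frac_ind=> m s; elim/frac_ind=> n t; elim/frac_ind=> k w.
rewrite !loc_addE; apply/frac_eq; exists 1; rewrite ?rpred1 //= !scale1r.
rewrite !scalerDr !scalerA addrA.
by congr (_ *: _ + _ *: _ + _ *: _); ring.
Qed.

Lemma loc_addC : commutative loc_add.
Proof.
elim/frac_ind=> m s; elim/frac_ind=> n t.
rewrite !loc_addE; apply/frac_eq; exists 1; rewrite ?rpred1 //= !scale1r.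
by rewrite addrC mulrC.
Qed.

Lemma loc_add0 : left_id loc_zero loc_add.
Proof.
elim/frac_ind=> m s; rewrite loc_addE; apply/frac_eq.
exists 1; rewrite ?rpred1 //= !scale1r scaler0 add0r.
by rewrite mul1r.
Qed.

Lemma loc_addN : left_inverse loc_zero loc_opp loc_add.
Proof.
elim/frac_ind=> m s; rewrite loc_oppE loc_addE; apply/frac_eq.
by exists 1; rewrite ?rpred1 //= !scale1r scalerN addNr scaler0.
Qed.

HB.instance Definition _ :=
  GRing.isZmodule.Build (loc M) loc_addA loc_addC loc_add0 loc_addN.

Lemma fracD m n s t :
  frac m s + frac n t = frac (sval t *: m + sval s *: n) (denM s t).
Proof. exact: loc_addE. Qed.

End ModuleTheory.

Definition loc_scale (M : lmodType R) (a : locr) (x : loc M) : loc M :=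
  frac ((loc_num a : R) *: loc_num x) (denM (loc_den a) (loc_den x)).

Lemma loc_scaleE (M : lmodType R) (a : R^o) (m : M) s t :
  loc_scale (frac a s) (frac m t) = frac ((a : R) *: m) (denM s t).
Proof.
rewrite /loc_scale; move: (loc_numden (frac a s)) (loc_numden (frac m t)).
move: (loc_num (frac a s)) (loc_den (frac a s)) => a' s'.
move: (loc_num (frac m t)) (loc_den (frac m t)) => m' t'.
move=> /frac_eq[u Su e] /frac_eq[v Sv f].
apply/frac_eq; exists (u * v); first by rewrite rpredM.
have {e}e : u * (sval s * a') = u * (sval s' * a) := e.
have {f}f := congr1 (fun z : M => (u * (sval s' * a)) *: z) f.
move: f; rewrite /= !scalerA => f.
transitivity ((u * (sval s * a') * v * sval t) *: m').
  by congr (_ *: _); ring.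
by rewrite e f; congr (_ *: _); ring.
Qed.

HB.instance Definition _ := GRing.Zmodule.on locr.

Definition locr_frac (a : R) (s : den) : locr := frac (a : R^o) s.

Lemma locr_ind (P : locr -> Prop) :
  (forall a s, P (locr_frac a s)) -> forall x, P x.
Proof. exact: (@frac_ind R^o). Qed.

Lemma locr_fracE (a b : R) s t :
  sval t * a = sval s * b -> locr_frac a s = locr_frac b t.
Proof. by move=> h; apply/frac_eq; exists 1; rewrite ?rpred1 // !scale1r. Qed.

Lemma locr_fracD (a b : R) s t :
  locr_frac a s + locr_frac b t =
  locr_frac (sval t * a + sval s * b) (denM s t).
Proof. exact: fracD. Qed.

Lemma loc_scaleEr (M : lmodType R) (a : R) (m : M) s t :
  loc_scale (locr_frac a s) (frac m t) = frac (a *: m) (denM s t).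
Proof. exact: loc_scaleE. Qed.

Definition locr_one : locr := locr_frac 1 den1.
Definition locr_mul (x y : locr) : locr := @loc_scale R^o x y.

Lemma locr_mulE (a b : R) s t :
  locr_mul (locr_frac a s) (locr_frac b t) = locr_frac (a * b) (denM s t).
Proof. exact: loc_scaleE. Qed.

Lemma locr_mulA : associative locr_mul.
Proof.
elim/locr_ind=> a s; elim/locr_ind=> b t; elim/locr_ind=> c w.
by rewrite !locr_mulE; apply: locr_fracE => /=; ring.
Qed.

Lemma locr_mulC : commutative locr_mul.
Proof.
elim/locr_ind=> a s; elim/locr_ind=> b t.
by rewrite !locr_mulE; apply: locr_fracE => /=; ring.
Qed.

Lemma locr_mul1 : left_id locr_one locr_mul.
Proof.
by elim/locr_ind=> a s; rewrite locr_mulE; apply: locr_fracE => /=; ring.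
Qed.

Lemma locr_mulDl : left_distributive locr_mul +%R.
Proof.
elim/locr_ind=> a s; elim/locr_ind=> b t; elim/locr_ind=> c w.
by rewrite !(locr_fracD, locr_mulE); apply: locr_fracE => /=; ring.
Qed.

HB.instance Definition _ := GRing.Zmodule_isComPzRing.Build locr
  locr_mulA locr_mulC locr_mul1 locr_mulDl.

Lemma loc_scaleA (M : lmodType R) (a b : locr) (x : loc M) :
  loc_scale a (loc_scale b x) = loc_scale (a * b) x.
Proof.
rewrite -[a * b]/(locr_mul a b).
elim/locr_ind: a => a s; elim/locr_ind: b => b t; elim/frac_ind: x => m w.
rewrite locr_mulE !loc_scaleEr; apply/frac_eq; exists 1; rewrite ?rpred1 //=.
by rewrite !scale1r !scalerA; congr (_ *: _); ring.
Qed.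

Lemma loc_scale1 (M : lmodType R) : left_id 1 (@loc_scale M).
Proof.
elim/frac_ind=> m s; rewrite -[1]/locr_one loc_scaleEr; apply/frac_eq; exists 1.
  by rewrite rpred1.
by rewrite /= !scale1r mul1r.
Qed.

Lemma loc_scaleDl (M : lmodType R) (x : loc M) :
  {morph (@loc_scale M)^~ x : a b / a + b}.
Proof.
elim/frac_ind: x => m w; elim/locr_ind=> a s; elim/locr_ind=> b t /=.
rewrite locr_fracD !loc_scaleEr fracD; apply/frac_eq.
exists 1; rewrite ?rpred1 //= !scale1r !scalerA -scalerDl scalerA.
by congr (_ *: _); ring.
Qed.

Lemma loc_scaleDr (M : lmodType R) : right_distributive (@loc_scale M) +%R.
Proof.
elim/locr_ind=> a s; elim/frac_ind=> m t; elim/frac_ind=> n w.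
rewrite fracD !loc_scaleEr fracD; apply/frac_eq; exists 1; rewrite ?rpred1 //=.
rewrite !scale1r !scalerDr !scalerA.
by congr (_ *: _ + _ *: _); ring.
Qed.

HB.instance Definition _ M := GRing.Zmodule_isLmodule.Build locr (loc M)
  (@loc_scaleA M) (@loc_scale1 M) (@loc_scaleDr M) (@loc_scaleDl M).

Lemma scale_frac (M : lmodType R) (a : R) (m : M) s t :
  locr_frac a s *: frac m t = frac (a *: m) (denM s t).
Proof. exact: loc_scaleE. Qed.

End Localization.

(* Not ring_quotient.v's idealr: those are proper by definition and require a
   nontrivial ring, whereas R may be the zero ring here. *)
Definition ideal (R : comPzRingType) (I : {pred R}) : Prop :=
  submod_closed (I : {pred R^o}).

Definition noetherian (R : comPzRingType) : Prop :=
  forall I : {pred R}, ideal I ->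
    exists (n : nat) (g : 'I_n -> R),
      forall x, x \in I <-> exists c : 'I_n -> R, x = \sum_i c i * g i.

Record spec (R : comPzRingType) := Spec {
  spec_pred :> {pred R};
  spec_ideal : ideal spec_pred;
  spec_proper : 1 \notin spec_pred;
  spec_prime : forall u v,
    u * v \in spec_pred -> (u \in spec_pred) || (v \in spec_pred)
}.

Record maxspec (R : comPzRingType) := MaxSpec {
  maxspec_pred :> {pred R};
  maxspec_ideal : ideal maxspec_pred;
  maxspec_proper : 1 \notin maxspec_pred;
  maxspec_max : forall J : {pred R}, ideal J -> 1 \notin J ->
    {subset maxspec_pred <= J} -> {subset J <= maxspec_pred}
}.

Lemma maxspec_prime (R : comPzRingType) (m : maxspec R) u v :
  u * v \in maxspec_pred m ->
  (u \in maxspec_pred m) || (v \in maxspec_pred m).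
Proof.
case: m => m mI m1 mmax /= uvm; have [um//|um/=] := boolP (u \in m).
have [m0 mlin] := mI.
have mMl a x : x \in m -> a * x \in m.
  by move=> xm; have := mlin a x 0 xm m0; rewrite addr0.
pose J : {pred R} := fun z => `[< exists2 x, x \in m & exists r, z = x + r * u >].
have JI : ideal J.
  split; first by apply/asboolP; exists 0 => //; exists 0; rewrite mul0r addr0.
  move=> a _ _ /asboolP[x xm [r ->]] /asboolP[y ym [q ->]].
  apply/asboolP; exists (a * x + y); first exact: mlin.
  by exists (a * r + q); rewrite /GRing.scale /=; ring.
have [J1|J1] := boolP (1 \in J); last first.
  case/negP: um; apply: (mmax J) => //.
    by move=> x xm; apply/asboolP; exists x => //; exists 0; rewrite mul0r addr0.
  by apply/asboolP; exists 0 => //; exists 1; rewrite mul1r add0r.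
case/asboolP: J1 => x xm [r e].
have -> : v = v * x + r * (u * v) by rewrite -[LHS]mulr1 e; ring.
exact: (mlin v x _ xm (mMl r _ uvm)).
Qed.

Definition spec_of_max (R : comPzRingType) (m : maxspec R) : spec R :=
  Spec (maxspec_ideal m) (maxspec_proper m) (@maxspec_prime R m).

Definition spec_compl (R : comPzRingType) (p : spec R) : {pred R} :=
  fun x => x \notin spec_pred p.

Lemma spec_compl_closed (R : comPzRingType) (p : spec R) :
  mulr_closed (spec_compl p).
Proof.
split=> [|u v]; first exact: spec_proper.
move=> up vp; rewrite -[_ \in _]/(u * v \notin spec_pred p).
have {}up : u \notin spec_pred p := up; have {}vp : v \notin spec_pred p := vp.
by apply/negP => /spec_prime; rewrite (negPf up) (negPf vp).
Qed.

HB.instance Definition _ (R : comPzRingType) (p : spec R) :=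
  GRing.isMulClosed.Build R (spec_compl p) (spec_compl_closed p).

Definition fin_gen (R : pzRingType) (M : lmodType R) : Prop :=
  exists (n : nat) (g : 'I_n -> M),
    forall x, exists c : 'I_n -> R, x = \sum_i c i *: g i.

(* The objects of mod R; morphisms are the {linear M -> N}. *)
Record fgmod (R : pzRingType) := FGMod {
  fgmod_sort :> lmodType R;
  fgmod_fin_gen : fin_gen fgmod_sort
}.

Lemma loc_fin_gen (R : comPzRingType) (S : mulrClosed R) (M : fgmod R) :
  fin_gen (loc S M).
Proof.
have [n [g gP]] := fgmod_fin_gen M.
exists n, (fun i => frac (g i) (den1 S)); elim/frac_ind=> m s.
have [c ->] := gP m; exists (fun i => locr_frac (c i) s).
have fD (x y : M) : frac (x + y) s = frac x s + frac y s :> loc S M.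
  rewrite fracD; apply/frac_eq; exists 1; rewrite ?rpred1 //= !scale1r.
  by rewrite -scalerDr scalerA.
have f1 (x : M) : frac x (denM s (den1 S)) = frac x s :> loc S M.
  by apply/frac_eq; exists 1; rewrite ?rpred1 //= mulr1.
have f0 : frac 0 s = 0 :> loc S M.
  by apply/frac_eq; exists 1; rewrite ?rpred1 //= !scaler0.
by elim/big_rec2: _ => [|i y x _ <-]; rewrite ?f0 // scale_frac fD f1.
Qed.

Definition fg_loc (R : comPzRingType) (p : spec R) (M : fgmod R) :
  fgmod (locr (spec_compl p)) := FGMod (loc_fin_gen (spec_compl p) M).

Definition lmod_iso (R : pzRingType) (M N : lmodType R) : Prop :=
  exists f : {linear M -> N}, bijective f.

Lemma lmod_iso_trans (R : pzRingType) (M N P : lmodType R) :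
  lmod_iso M N -> lmod_iso N P -> lmod_iso M P.
Proof.
move=> [f bf] [g bg]; exists (g \o f : {linear M -> P}).
exact: bij_comp.
Qed.

(* A full subcategory closed under isomorphisms is given by its objects. *)
Record subcat (R : pzRingType) := Subcat {
  subcat_obj :> fgmod R -> Prop;
  subcat_iso : forall M N : fgmod R, lmod_iso M N -> subcat_obj M -> subcat_obj N
}.

Section Closure.
Variables (R : pzRingType) (X : subcat R).

(* Finite direct sums are the empty one (a zero module) and the binary ones; they
   are given up to isomorphism, which is harmless as X is closed under it. *)
Definition additive_subcat : Prop :=
  (forall Z : fgmod R, (forall z : Z, z = 0) -> X Z) /\
  (forall M N P : fgmod R, lmod_iso P (M * N)%type -> X M -> X N -> X P).

Definition summand_closed : Prop :=
  forall M N P : fgmod R, lmod_iso P (M * N)%type -> X P -> X M.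

Definition short_exact (L M N : lmodType R)
    (f : {linear L -> M}) (g : {linear M -> N}) : Prop :=
  [/\ injective f,
      forall y, g y = 0 <-> exists x, f x = y
    & forall z, exists y, g y = z].

Definition ext_closed : Prop :=
  forall (L M N : fgmod R) (f : {linear L -> M}) (g : {linear M -> N}),
    short_exact f g -> X L -> X N -> X M.

Definition is_kernel (K M N : lmodType R)
    (i : {linear K -> M}) (f : {linear M -> N}) : Prop :=
  injective i /\ forall y, f y = 0 <-> exists x, i x = y.

Definition ker_closed : Prop :=
  forall (M N : fgmod R) (f : {linear M -> N}), X M -> X N ->
    forall (K : fgmod R) (i : {linear K -> M}), is_kernel i f -> X K.

Definition ke_closed : Prop := ext_closed /\ ker_closed.

End Closure.

Section SubcatLoc.
Variables (R : comPzRingType) (X : subcat R) (p : spec R).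

Definition subcat_loc_obj (N : fgmod (locr (spec_compl p))) : Prop :=
  exists2 M : fgmod R, X M & lmod_iso (fg_loc p M) N.

Lemma subcat_loc_iso (M N : fgmod (locr (spec_compl p))) :
  lmod_iso M N -> subcat_loc_obj M -> subcat_loc_obj N.
Proof. by move=> iMN [K XK iK]; exists K => //; apply: lmod_iso_trans iMN. Qed.

Definition subcat_loc : subcat (locr (spec_compl p)) := Subcat subcat_loc_iso.

End SubcatLoc.

(* Main.v *)
Require Import Defs.
From HB Require Import structures.
From mathcomp Require Import all_boot all_algebra.
From mathcomp Require Import boolp classical_sets.
From mathcomp Require Import ring.
Import Defs.

(** Passing to a localization and coming back rest on one fact: over a
    noetherian ring, [Hom] from a finitely generated module commutes with
    localization ([hom_lift]), so that a map defined over [R_p] is, up to a unit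
    of [R_p], the localization of a map defined over [R].

    From [R] to [R_p]. A morphism of [X_p] comes from a morphism of [X] up to a
    unit, and localization preserves kernels; this settles closure under kernels
    ([ker_closed_loc]). An extension of [N_p] by [L_p] is classified by a map
    from the kernel of a free cover of [N] to [L_p]; up to a unit this map comes
    from a map into [L], and pushing out along the latter gives an extension of
    [N] by [L] whose localization is the given one ([ext_closed_loc]).

    From the maximal ideals to [R]. As localization is exact, it suffices that a
    finitely generated [M] lies in [X] as soon as every [M_m] lies in [X_m]
    ([local_global]). An isomorphism of [M_m] with [C_m], for [C] in [X], and
    its inverse lift to maps whose composite is multiplication by some [r]
    outside [m] on [M]. The scalars [r] such that multiplication by [r] on [M]
    factors through an object of [X] form an ideal, as [X] is closed under
    finite direct sums. Being contained in no maximal ideal, it contains [1], so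
    that [M] is a direct summand of an object of [X]. *)

Set Implicit Arguments.
Unset Strict Implicit.
Unset Printing Implicit Defensive.

Import GRing.Theory.
Local Open Scope ring_scope.
Local Open Scope quotient_scope.

(** * Kernels and cokernels *)

Definition to_linear (R : pzRingType) (M N : lmodType R) (f : M -> N)
    (fL : linear f) : {linear M -> N} :=
  HB.pack f (GRing.isLinear.Build R M N *:%R f fL).

Lemma lmod_iso_refl (R : pzRingType) (M : lmodType R) : lmod_iso M M.
Proof. by exists (to_linear (f := @id M) (fun a x y => erefl)); exists id. Qed.

Lemma factor_surj (A B C : Type) (q : A -> B) (k : A -> C) :
  (forall b, exists a, q a = b) -> (forall x y, q x = q y -> k x = k y) ->
  exists k' : B -> C, forall x, k' (q x) = k x.
Proof.
move=> /choice[r rK] qk; exists (k \o r) => x.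
by apply: qk; rewrite rK.
Qed.

Section Kernel.
Variables (R : pzRingType) (M N : lmodType R) (f : {linear M -> N}).

Definition ker_pred : {pred M} := fun x => f x == 0.

Lemma ker_predP x : reflect (f x = 0) (x \in ker_pred).
Proof. exact: eqP. Qed.

Lemma ker_pred_closed : submod_closed ker_pred.
Proof.
split=> [|a x y /ker_predP fx /ker_predP fy]; apply/ker_predP.
  exact: linear0.
by rewrite linearP fx fy scaler0 addr0.
Qed.

HB.instance Definition _ := GRing.isSubmodClosed.Build R M ker_pred
  (GRing.submod_closed_semi ker_pred_closed).

Definition kernel : Type := {x : M | x \in ker_pred}.
HB.instance Definition _ := SubChoice.on kernel.
HB.instance Definition _ := [SubChoice_isSubLmodule of kernel by <:].

Definition ker_incl : {linear kernel -> M} :=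
  to_linear (f := val : kernel -> M) (fun a x y => erefl).

Lemma ker_inclP : is_kernel ker_incl f.
Proof.
split=> [|y]; first exact: val_inj.
split=> [/ker_predP ky|[x <-]]; last exact/ker_predP/(valP x).
by exists (Sub y ky).
Qed.

End Kernel.
Arguments ker_incl : simpl never.

Section Cokernel.
Variables (R : pzRingType) (M N : lmodType R) (h : {linear M -> N}).

Definition im_pred : {pred N} := fun y => `[< exists x, h x = y >].

Lemma im_predP y : reflect (exists x, h x = y) (y \in im_pred).
Proof. exact: asboolP. Qed.

Lemma im_pred_closed : zmod_closed im_pred.
Proof.
split=> [|_ _ /im_predP[x <-] /im_predP[y <-]]; apply/im_predP.
  by exists 0; rewrite linear0.
by exists (x - y); rewrite linearB.
Qed.

HB.instance Definition _ := GRing.isZmodClosed.Build N im_pred im_pred_closed.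

(** The quotient of additive groups; the action of [R] is put on it below. *)
Definition cokernel : Type := Quotient.quot im_pred.
HB.instance Definition _ := GRing.Zmodule.on cokernel.

Definition coker_pi (y : N) : cokernel := \pi_(Quotient.quot im_pred) y.

Lemma coker_piP x y : coker_pi x = coker_pi y <-> exists z, h z = x - y.
Proof.
rewrite /coker_pi; split=> [/eqP|e].
  by rewrite -Quotient.idealrBE => /im_predP.
by apply/eqP; rewrite -Quotient.idealrBE; apply/im_predP.
Qed.

Lemma coker_ind (P : cokernel -> Prop) :
  (forall y, P (coker_pi y)) -> forall x, P x.
Proof. by move=> h1 x; rewrite -[x]reprK; apply: h1. Qed.

Lemma coker_piD : {morph coker_pi : x y / x + y}.
Proof. by move=> x y; rewrite /coker_pi; rewrite raddfD. Qed.

Definition coker_scale (a : R) (x : cokernel) : cokernel :=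
  coker_pi (a *: repr (x : Quotient.quot im_pred)).

Lemma coker_scaleE a y : coker_scale a (coker_pi y) = coker_pi (a *: y).
Proof.
have /coker_piP[z e] : coker_pi (repr (coker_pi y)) = coker_pi y.
  exact: reprK.
by apply/coker_piP; exists (a *: z); rewrite linearZ /= e scalerBr.
Qed.

Lemma coker_scaleA a b x :
  coker_scale a (coker_scale b x) = coker_scale (a * b) x.
Proof. by elim/coker_ind: x => y; rewrite !coker_scaleE scalerA. Qed.
Lemma coker_scale1 : left_id 1 coker_scale.
Proof. by elim/coker_ind => y; rewrite !coker_scaleE scale1r. Qed.
Lemma coker_scaleDr : right_distributive coker_scale +%R.
Proof.
move=> a; elim/coker_ind=> x; elim/coker_ind=> y.
by rewrite -coker_piD !coker_scaleE -coker_piD scalerDr.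
Qed.
Lemma coker_scaleDl x : {morph coker_scale^~ x : a b / a + b}.
Proof.
by elim/coker_ind: x => y a b; rewrite !coker_scaleE -coker_piD scalerDl.
Qed.
HB.instance Definition _ := GRing.Zmodule_isLmodule.Build R cokernel
  coker_scaleA coker_scale1 coker_scaleDr coker_scaleDl.

Lemma coker_pi_linear : linear coker_pi.
Proof. by move=> a x y; rewrite coker_piD -coker_scaleE. Qed.

Definition coker_proj : {linear N -> cokernel} := to_linear coker_pi_linear.

Lemma coker_projP x y : coker_proj x = coker_proj y <-> exists z, h z = x - y.
Proof. exact: coker_piP. Qed.

Lemma coker_proj_surj x : exists y, coker_proj y = x.
Proof. by elim/coker_ind: x => y; exists y. Qed.

End Cokernel.
Arguments coker_proj : simpl never.

(** * Finitely generated and noetherian modules *)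

Section Span.
Variables (R : pzRingType) (M : lmodType R).
Implicit Types (P : M -> Prop) (s : seq M).

Definition submodule P := P 0 /\ forall a x y, P x -> P y -> P (a *: x + y).

Lemma submoduleD P x y : submodule P -> P x -> P y -> P (x + y).
Proof. by move=> [_ PD] Px Py; rewrite -[x]scale1r; apply: PD. Qed.

Lemma submoduleZ P a x : submodule P -> P x -> P (a *: x).
Proof. by move=> [P0 PD] Px; rewrite -[_ *: _]addr0; apply: PD. Qed.

Lemma submoduleB P x y : submodule P -> P x -> P y -> P (x - y).
Proof. by move=> [_ PD] Px Py; rewrite addrC -scaleN1r; apply: PD. Qed.

(** Generation by a list, the coefficient of one generator at a time, so that
    statements about generators are proved by induction on the list. *)
Fixpoint span s x : Prop :=
  if s is g :: s' then exists a, span s' (x - a *: g) else x = 0.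

Lemma span_submodule s : submodule (span s).
Proof.
elim: s => [|g s [IH0 IHD]].
  by split=> //= a x y -> ->; rewrite scaler0 addr0.
split=> /= [|a x y [b sx] [c sy]]; first by exists 0; rewrite scale0r subr0.
exists (a * b + c); suff -> : a *: x + y - (a * b + c) *: g =
  a *: (x - b *: g) + (y - c *: g) by apply: IHD.
by rewrite scalerDl -scalerA scalerBr opprD addrACA.
Qed.

Lemma span_mem s g : g \in s -> span s g.
Proof.
elim: s => //= h s IH; rewrite inE => /predU1P[->|gs].
  by exists 1; rewrite scale1r subrr; case: (span_submodule s).
by exists 0; rewrite scale0r subr0; apply: IH.
Qed.

Lemma span_min P s : submodule P -> (forall g, g \in s -> P g) ->
  forall x, span s x -> P x.
Proof.
move=> PS; elim: s => [|g s IH] sP x /= => [->|[a ax]]; first by case: PS.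
rewrite -[x](subrK (a *: g)) addrC; apply: (submoduleD PS).
  by apply: submoduleZ => //; apply: sP; rewrite mem_head.
by apply: IH => // h hs; apply: sP; rewrite inE hs orbT.
Qed.

Arguments span_min P [s].

Definition fg_sub P := exists2 s, (forall g, g \in s -> P g) &
  forall x, P x -> span s x.

Lemma span_codom n (g : 'I_n -> M) x :
  span (codom g) x <-> exists c : 'I_n -> R, x = \sum_i c i *: g i.
Proof.
split.
  pose P y := exists c : 'I_n -> R, y = \sum_i c i *: g i.
  apply: (span_min P); first split.
  - by exists (fun=> 0); rewrite big1 // => i _; rewrite scale0r.
  - move=> a _ _ [c ->] [d ->]; exists (fun i => a * c i + d i).
    rewrite scaler_sumr -big_split; apply: eq_bigr => i _.
    by rewrite scalerDl scalerA.
  - move=> _ /codomP[i ->]; exists (fun j => (j == i)%:R).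
    rewrite (bigD1 i) //= eqxx scale1r big1 ?addr0 // => j /negPf->.
    by rewrite scale0r.
have sS := span_submodule (codom g).
move=> [c ->]; elim/big_ind: _ => [|y z|i _]; first by case: sS.
  exact: submoduleD.
by apply: submoduleZ => //; apply/span_mem/codom_f.
Qed.

Lemma fin_genP : fin_gen M <-> exists s, forall x, span s x.
Proof.
split=> [[n [g gP]]|[s sP]]; first by exists (codom g) => x; apply/span_codom.
exists (size s), (fun i => s`_i) => x; apply/span_codom.
suff -> : codom (fun i : 'I_(size s) => s`_i) = s by [].
apply: (@eq_from_nth _ 0); rewrite size_codom card_ord // => i lti.
by rewrite (nth_map (Ordinal lti)) ?size_enum_ord // nth_enum_ord.
Qed.

End Span.
Arguments span_min [R M] P [s].

Section FinGen.
Variable R : pzRingType.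

Lemma preim_submodule (M N : lmodType R) (f : {linear M -> N}) P :
  submodule P -> submodule (fun x => P (f x)).
Proof.
move=> [P0 PD]; split=> [|a x y Px Py]; first by rewrite linear0.
by rewrite linearP; apply: PD.
Qed.

Lemma image_submodule (M N : lmodType R) (f : {linear M -> N}) P :
  submodule P -> submodule (fun y => exists2 x, P x & f x = y).
Proof.
move=> [P0 PD]; split=> [|a _ _ [x Px <-] [y Py <-]].
  by exists 0; rewrite ?linear0.
by exists (a *: x + y); [apply: PD | rewrite linearP].
Qed.

Lemma fin_gen_image (M N : lmodType R) (f : {linear M -> N}) :
  (forall y, exists x, f x = y) -> fin_gen M -> fin_gen N.
Proof.
move=> f_surj /fin_genP[s sP]; apply/fin_genP; exists (map f s) => y.
have [x <-] := f_surj y.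
apply: (span_min (fun x => span (map f s) (f x)) _ _ _ (sP x)) => [|g gs].
  exact/preim_submodule/span_submodule.
exact/span_mem/map_f.
Qed.

(** Images of generators of [L] and lifts of generators of [N] generate [M]. *)
Lemma fin_gen_ext (L M N : lmodType R) (f : {linear L -> M})
    (g : {linear M -> N}) :
  (forall y, g y = 0 -> exists x, f x = y) -> (forall z, exists y, g y = z) ->
  fin_gen L -> fin_gen N -> fin_gen M.
Proof.
move=> f_ker g_surj /fin_genP[s sP] /fin_genP[t tP]; apply/fin_genP.
have [t' tE] : exists t', map g t' = t.
  elim: t {tP} => [|z t [t' <-]]; first by exists [::].
  by have [y <-] := g_surj z; exists (y :: t').
exists (map f s ++ t') => y; set Q := span _.
have QS : submodule Q by apply: span_submodule.
have [y' Qy' e] : exists2 y', Q y' & g y' = g y.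
  apply: (span_min (fun z => exists2 y', Q y' & g y' = z) _ _ _
    (tP (g y))) => [|z]; last first.
    rewrite -tE => /mapP[y' y't ->]; exists y' => //.
    by apply: span_mem; rewrite mem_cat y't orbT.
  exact: image_submodule.
have [|x fx] := f_ker (y - y'); first by rewrite linearB e subrr.
rewrite -[y](subrK y') -fx; apply: submoduleD => //.
apply: (span_min (fun x => Q (f x)) _ _ _ (sP x)) => [|h hs].
  exact: preim_submodule.
by apply: span_mem; rewrite mem_cat map_f.
Qed.

Lemma fin_gen_prod (M N : lmodType R) :
  fin_gen M -> fin_gen N -> fin_gen (M * N)%type.
Proof.
have inlL : linear (fun x : M => (x, 0 : N)).
  by move=> a x y; congr (_, _); rewrite /= scaler0 addr0.
apply: (@fin_gen_ext _ _ _ (to_linear inlL) (@snd M N)) => // [[x y] /= ->|y].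
  by exists x.
by exists (0, y).
Qed.

Lemma fin_gen_sub (M K : lmodType R) (i : {linear K -> M}) :
  injective i -> fg_sub (fun y => exists x, i x = y) -> fin_gen K.
Proof.
move=> i_inj [s s_im s_span]; apply/fin_genP.
have [t tE] : exists t, map i t = s.
  elim: s s_im {s_span} => [|z s IH] s_im; first by exists [::].
  have [|t <-] := IH; first by move=> g gs; apply: s_im; rewrite inE gs orbT.
  by have [x <-] := s_im z (mem_head _ _); exists (x :: t).
exists t => x; have [x' tx' /i_inj <-//] :
    exists2 x', span t x' & i x' = i x.
apply: (span_min (fun y => exists2 x', span t x' & i x' = y) _ _ _
  (s_span (i x) (ex_intro _ x erefl))) => [|g].
  exact/image_submodule/span_submodule.
by rewrite -tE => /mapP[x' x't ->]; exists x' => //; apply: span_mem.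
Qed.

Lemma fin_gen_row n : fin_gen 'rV[R]_n.
Proof.
exists n, (fun i => delta_mx 0 i) => x; exists (fun i => x 0 i).
exact: row_sum_delta.
Qed.

End FinGen.

Section Noetherian.
Variables (R : comPzRingType) (noethR : noetherian R).

Lemma noetherian_ideal (I : R -> Prop) :
  submodule (I : R^o -> Prop) -> fg_sub (I : R^o -> Prop).
Proof.
move=> [I0 ID]; have [|n [g gP]] := noethR (I := fun x => `[< I x >]).
  by split=> [|a x y /asboolP Ix /asboolP Iy]; apply/asboolP => //; apply: ID.
have {}gP x : I x <-> span (codom (g : 'I_n -> R^o)) (x : R^o).
  have gx := @span_codom R R^o n g x.
  by split=> [/asboolP/gP/gx.2|/gx.1/gP/asboolP].
by exists (codom (g : 'I_n -> R^o)) => x => [xg|/gP//]; apply/gP/span_mem.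
Qed.

(** Induction on the generators. The coefficients along the first generator [g]
    of the elements of [P] form an ideal, which is finitely generated; lifts of
    its generators to [P], with generators of the intersection of [P] and the
    span of the other generators, generate [P]. *)
Lemma noetherian_sub_span (M : lmodType R) (s : seq M) (P : M -> Prop) :
  submodule P -> (forall x, P x -> span s x) -> fg_sub P.
Proof.
elim: s P => [|g s IH] P PS Ps; first by exists [::].
have sS := span_submodule s.
have [t tI tspan] :
    fg_sub (fun r : R^o => exists2 y, P y & span s (y - r *: g)).
  apply: noetherian_ideal; split=> [|a r q [y Py ry] [z Pz qz]].
    exists 0; first by case: PS.
    by rewrite scale0r subr0; case: sS.
  exists (a *: y + z); first exact: PS.2.
  suff -> : a *: y + z - ((a *: r + q) : R^o) *: g =
    a *: (y - r *: g) + (z - q *: g) by apply: sS.2.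
  by rewrite scalerDl -scalerA scalerBr opprD addrACA.
have [u uP uspan] : fg_sub (fun x => P x /\ span s x).
  apply: IH => [|x []//]; split=> [|a x y [Px sx] [Py sy]].
    by split; [case: PS | case: sS].
  by split; [apply: PS.2 | apply: sS.2].
(* v consists of lifts to P of the generators t of the ideal *)
have [v vP tv] : exists2 v : seq M, (forall y, y \in v -> P y) &
    forall r, r \in t -> exists2 y, y \in v & span s (y - r *: g).
  elim: t tI {tspan} => [|r t IHt] tI; first by exists [::].
  have [|v vP tv] := IHt; first by move=> q qt; apply: tI; rewrite inE qt orbT.
  have [y Py ry] := tI r (mem_head _ _); exists (y :: v).
    by move=> z; rewrite inE => /predU1P[->//|/vP].
  move=> q; rewrite inE => /predU1P[->|/tv[z zv qz]].
    by exists y; rewrite ?mem_head.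
  by exists z; rewrite // inE zv orbT.
have vuS := span_submodule (v ++ u).
exists (v ++ u) => [y|x Px]; first by rewrite mem_cat => /orP[/vP|/uP[]].
have [r rx] := Ps x Px.
have [y [Py vy ry]] : exists y, [/\ P y, span (v ++ u) y & span s (y - r *: g)].
  apply: (span_min (fun q : R^o => exists y,
    [/\ P y, span (v ++ u) y & span s (y - q *: g)]) (s := t)); last first.
  - by apply: tspan; exists x.
  - move=> q /tv[y yv qy]; exists y; split=> //; first exact: vP.
    by apply: span_mem; rewrite mem_cat yv.
  - split=> [|a p q [y [Py vy py]] [z [Pz vz qz]]].
      exists 0; rewrite scale0r subr0; split; [by case: PS | by case: vuS |].
      by case: sS.
    exists (a *: y + z); split; [exact: PS.2 | exact: vuS.2 |].
    suff -> : a *: y + z - ((a *: p + q) : R^o) *: g =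
      a *: (y - p *: g) + (z - q *: g) by apply: sS.2.
    by rewrite scalerDl -scalerA scalerBr opprD addrACA.
rewrite -[x](subrK y); apply: submoduleD => //.
apply: (span_min (span (v ++ u)) (s := u)) => // [h hu|].
  by apply: span_mem; rewrite mem_cat hu orbT.
apply: uspan; split; first exact: submoduleB.
have -> : x - y = (x - r *: g) - (y - r *: g) by rewrite opprB addrA subrK.
exact: submoduleB.
Qed.

Lemma noetherian_submodule (M : lmodType R) (P : M -> Prop) :
  fin_gen M -> submodule P -> fg_sub P.
Proof.
by move=> /fin_genP[s sP] PS; apply: (noetherian_sub_span (s := s)).
Qed.

Lemma noetherian_inj_fin_gen (M K : lmodType R) (i : {linear K -> M}) :
  injective i -> fin_gen M -> fin_gen K.
Proof.
move=> i_inj fgM; apply: (fin_gen_sub i_inj).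
apply: noetherian_submodule => //.
split=> [|a _ _ [x <-] [y <-]]; first by exists 0; rewrite linear0.
by exists (a *: x + y); rewrite linearP.
Qed.

End Noetherian.

(** * Localization of modules and homomorphisms *)

Section Localization.
Variables (R : comPzRingType) (S : mulrClosed R).
Implicit Types (M N : lmodType R) (P Q : lmodType (locr S)).

Definition scal (a : R) : locr S := locr_frac a (den1 S).
Definition iota_loc M (m : M) : loc S M := frac m (den1 S).

Lemma locr_fracM (a b : R) (s t : den S) :
  locr_frac a s * locr_frac b t = locr_frac (a * b) (denM s t).
Proof. exact: locr_mulE. Qed.

Lemma scalM a b : scal (a * b) = scal a * scal b.
Proof.
by rewrite locr_fracM; apply: locr_fracE => /=; ring.
Qed.

Lemma scalD a b : scal (a + b) = scal a + scal b.
Proof. by rewrite locr_fracD; apply: locr_fracE => /=; ring. Qed.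

Lemma scal1 : scal 1 = 1.
Proof. by []. Qed.

Lemma den_invK (s : den S) : locr_frac 1 s * scal (sval s) = 1.
Proof.
by rewrite locr_fracM -scal1; apply: locr_fracE => /=; ring.
Qed.

Lemma scal_inv s : s \in S -> exists a : locr S, a * scal s = 1.
Proof. by move=> Ss; exists (locr_frac 1 (exist _ s Ss)); rewrite den_invK. Qed.

Lemma scal_inj Q s : s \in S -> injective (fun x : Q => scal s *: x).
Proof.
move=> /scal_inv[a a1] x y /(congr1 ( *:%R a)).
by rewrite !scalerA a1 !scale1r.
Qed.

Lemma fracE M (m : M) s : frac m s = locr_frac 1 s *: iota_loc m :> loc S M.
Proof.
rewrite scale_frac scale1r; apply/frac_eq; exists 1; first exact: rpred1.
by rewrite /= mulr1.
Qed.

Lemma scal_den_frac M (m : M) s :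
  scal (sval s) *: frac m s = iota_loc m :> loc S M.
Proof. by rewrite fracE scalerA mulrC den_invK scale1r. Qed.

Lemma iota_locP M (x : loc S M) : exists s, exists m,
  s \in S /\ scal s *: x = iota_loc m.
Proof.
elim/frac_ind: x => m s; exists (sval s), m.
by rewrite scal_den_frac; split=> //; apply: (svalP s).
Qed.

(** A module [Q] over the localized ring is never given a second structure over
    [R]: a map [M -> Q] linear over [R] is expressed by letting [a] act on [Q]
    as [a / 1]. *)
Definition loc_linear M Q (phi : M -> Q) :=
  forall a x y, phi (a *: x + y) = scal a *: phi x + phi y.

Lemma iota_loc_linear M : loc_linear (@iota_loc M).
Proof.
move=> a x y; rewrite scale_frac fracD; apply/frac_eq; exists 1.
  exact: rpred1.
by rewrite /= !mulr1 !scale1r.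
Qed.

Lemma iota_eq0 M (m : M) :
  iota_loc m = 0 <-> exists2 u, u \in S & u *: m = 0.
Proof.
split=> [/frac_eq[u Su]|[u Su e]]; last (apply/frac_eq; exists u => //).
  by rewrite /= !scale1r scaler0; exists u.
by rewrite /= !scale1r e scaler0.
Qed.

Section LocLinear.
Variables (M : lmodType R) (Q : lmodType (locr S)) (phi : M -> Q).
Hypothesis phiL : loc_linear phi.

Lemma loc_linearD x y : phi (x + y) = phi x + phi y.
Proof. by rewrite -{1}[x]scale1r phiL scal1 scale1r. Qed.

Lemma loc_linear0 : phi 0 = 0.
Proof. by apply: (addrI (phi 0)); rewrite -loc_linearD !addr0. Qed.

Lemma loc_linearZ a x : phi (a *: x) = scal a *: phi x.
Proof. by rewrite -[in LHS](addr0 (a *: x)) phiL loc_linear0 addr0. Qed.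

Lemma loc_linearN x : phi (- x) = - phi x.
Proof. by apply: (addrI (phi x)); rewrite -loc_linearD !subrr loc_linear0. Qed.

Lemma loc_linearB x y : phi (x - y) = phi x - phi y.
Proof. by rewrite loc_linearD loc_linearN. Qed.

Lemma loc_linear_comp P (f : {linear Q -> P}) : loc_linear (fun x => f (phi x)).
Proof. by move=> a x y; rewrite phiL linearP. Qed.

Lemma loc_linear_precomp N (f : {linear N -> M}) :
  loc_linear (fun x => phi (f x)).
Proof. by move=> a x y; rewrite linearP phiL. Qed.

(** The universal property of [S^-1 M]: the extension sends [m / s] to
    [s^-1 phi m]. *)
Lemma loc_lift : exists f : {linear loc S M -> Q},
  forall m, f (iota_loc m) = phi m.
Proof.
pose f (x : loc S M) := locr_frac 1 (loc_den x) *: phi (loc_num x).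
have invK (s : den S) (x : Q) : scal (sval s) *: (locr_frac 1 s *: x) = x.
  by rewrite scalerA mulrC den_invK scale1r.
have fE m s : f (frac m s) = locr_frac 1 s *: phi m.
  rewrite /f; have /frac_eq[u Su /= e] := loc_numden (frac m s : loc S M).
  apply: (scal_inj (svalP s)); apply: (scal_inj (svalP (loc_den (frac m s)))).
  apply: (scal_inj Su); rewrite /= invK [scal (sval s) *: _]scalerA mulrC.
  by rewrite -[(_ * _) *: _]scalerA invK -!loc_linearZ e.
have fL : linear f.
  move=> a; elim/locr_ind: a => a r; elim/frac_ind=> m s; elim/frac_ind=> n t.
  rewrite scale_frac fracD !fE; apply: (scal_inj (svalP (denM (denM r s) t))).
  rewrite invK /= phiL !loc_linearZ scalerDr !scalM.
  have e : locr_frac a r = scal a * locr_frac 1 r.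
    rewrite locr_fracM; apply: locr_fracE => /=; ring.
  rewrite e !scalerA; congr (_ *: _ + _ *: _).
    transitivity ((scal (sval t) * scal a) * (locr_frac 1 r * scal (sval r)) *
                  (locr_frac 1 s * scal (sval s))); last by ring.
    by rewrite !den_invK !mulr1.
  by rewrite -mulrA [scal _ * locr_frac _ _]mulrC den_invK mulr1.
exists (to_linear fL) => m; rewrite [LHS]fE.
by rewrite -[RHS]scale1r -scal1.
Qed.

End LocLinear.

(** The intrinsic characterization, up to isomorphism, of the canonical map
    [M -> S^-1 M] ([loc_isoP]); its clauses can be checked on a map into an
    arbitrary module, so that isomorphisms with [S^-1 M] need not be carried
    along. *)
Definition localizing M Q (lam : M -> Q) :=
  [/\ loc_linear lam,
      forall x, lam x = 0 <-> exists2 u, u \in S & u *: x = 0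
    & forall y, exists s, exists x, s \in S /\ scal s *: y = lam x].

Lemma iota_localizing M : localizing (@iota_loc M).
Proof.
by split; [exact: iota_loc_linear | exact: iota_eq0 | exact: iota_locP].
Qed.

Lemma loc_isoP M Q :
  lmod_iso (loc S M) Q <-> exists lam : M -> Q, localizing lam.
Proof.
split=> [[f [g fK gK]]|[lam [lamL lam0 lam_surj]]].
  exists (fun m => f (iota_loc m)); split=> [|x|y].
  - exact/loc_linear_comp/iota_loc_linear.
  - rewrite -iota_eq0 -(linear0 f); split=> [/(can_inj fK)//|->//].
  - have [s [m [Ss e]]] := iota_locP (g y); exists s, m; split=> //.
    by rewrite -e linearZ /= gK.
have [f fE] := loc_lift lamL.
have f_inj : injective f.
  apply: raddf_inj => x fx; have [s [m [Ss sx]]] := iota_locP x.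
  apply: (scal_inj Ss); rewrite /= scaler0 sx; apply/iota_eq0/lam0.
  by rewrite -fE -sx linearZ /= fx scaler0.
have f_surj y : exists x, f x = y.
  have [s [x [Ss sy]]] := lam_surj y; have [a a1] := scal_inv Ss.
  exists (a *: iota_loc x).
  by rewrite linearZ /= fE -sy scalerA a1 scale1r.
have [g gK] := choice f_surj; exists f; exists g => // x.
by apply: f_inj; rewrite gK.
Qed.

Lemma loc_map M N (f : {linear M -> N}) :
  exists F : {linear loc S M -> loc S N},
    forall m, F (iota_loc m) = iota_loc (f m).
Proof. exact/loc_lift/loc_linear_precomp/iota_loc_linear. Qed.

Section Exactness.
Variables (L M N : lmodType R) (f : {linear L -> M}) (g : {linear M -> N}).
Variables (F : {linear loc S L -> loc S M}) (G : {linear loc S M -> loc S N}).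
Hypothesis FE : forall x, F (iota_loc x) = iota_loc (f x).
Hypothesis GE : forall y, G (iota_loc y) = iota_loc (g y).

Lemma loc_map_inj : injective f -> injective F.
Proof.
move=> f_inj; apply: raddf_inj => x Fx; have [s [m [Ss sx]]] := iota_locP x.
apply: (scal_inj Ss); rewrite /= scaler0 sx; apply/iota_eq0.
have /iota_eq0[u Su fu] : iota_loc (f m) = 0.
  by rewrite -FE -sx linearZ /= Fx scaler0.
by exists u => //; apply: f_inj; rewrite linearZ /= fu linear0.
Qed.

Lemma loc_map_surj :
  (forall y, exists x, f x = y) -> forall y, exists x, F x = y.
Proof.
move=> f_surj y; have [s [n [Ss sy]]] := iota_locP y.
have [m fm] := f_surj n; have [a a1] := scal_inv Ss.
by exists (a *: iota_loc m); rewrite linearZ /= FE fm -sy scalerA a1 scale1r.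
Qed.

Lemma loc_map_exact : (forall y, g y = 0 <-> exists x, f x = y) ->
  forall y, G y = 0 <-> exists x, F x = y.
Proof.
move=> fg y; split=> [Gy|[x <-]].
  have [s [m [Ss sy]]] := iota_locP y.
  have /iota_eq0[u Su gu] : iota_loc (g m) = 0.
    by rewrite -GE -sy linearZ /= Gy scaler0.
  have [|x fx] := (fg (u *: m)).1; first by rewrite linearZ.
  have [a a1] := scal_inv Ss; have [b b1] := scal_inv Su.
  exists (a *: (b *: iota_loc x)); rewrite !linearZ /= FE fx.
  rewrite (loc_linearZ (@iota_loc_linear _)) -sy (scalerA b) b1 scale1r.
  by rewrite scalerA a1 scale1r.
have [s [m [Ss sx]]] := iota_locP x; apply: (scal_inj Ss).
rewrite /= scaler0 -!linearZ /= sx FE GE (_ : g _ = 0); last first.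
  by apply/fg; exists m.
exact/loc_linear0/iota_loc_linear.
Qed.

End Exactness.

Section HomLift.
Hypothesis noethR : noetherian R.

(** The torsion submodule is finitely generated, so one denominator, a product
    of annihilators of its generators, kills all of it. *)
Lemma localizing_torsion_bound N Q (lam : N -> Q) :
  fin_gen N -> localizing lam ->
  exists2 u, u \in S & forall x, lam x = 0 -> u *: x = 0.
Proof.
move=> fgN [lamL lam0 _].
have torS : submodule (fun x => lam x = 0).
  split=> [|a x y ax ay]; first exact: loc_linear0.
  by rewrite lamL ax ay scaler0 addr0.
have [s s_tor s_span] := noetherian_submodule noethR fgN torS.
have [u Su us] : exists2 u, u \in S & forall x, x \in s -> u *: x = 0.
  elim: s s_tor {s_span} => [|x s IH] s_tor; first by exists 1; rewrite ?rpred1.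
  have [|u Su us] := IH.
    by move=> y ys; apply: s_tor; rewrite inE ys orbT.
  have [v Sv vx] := (lam0 x).1 (s_tor x (mem_head _ _)).
  exists (u * v) => [|y]; first exact: rpredM.
  rewrite inE => /predU1P[->|/us uy]; first by rewrite -scalerA vx scaler0.
  by rewrite mulrC -scalerA uy scaler0.
exists u => // x /s_span; apply: (span_min (fun x => u *: x = 0)) => //.
split=> [|a y z uy uz]; first exact: scaler0.
by rewrite scalerDr uz scalerA mulrC -scalerA uy scaler0 addr0.
Qed.

Lemma common_denominator M N Q (lam : N -> Q) (phi : M -> Q) :
  fin_gen M -> localizing lam -> loc_linear phi ->
  exists2 s, s \in S & forall x, exists y, scal s *: phi x = lam y.
Proof.
move=> /fin_genP[e eP] [lamL _ lam_surj] phiL.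
have [s Ss es] : exists2 s, s \in S &
    forall x, x \in e -> exists y, scal s *: phi x = lam y.
  elim: e {eP} => [|x e [s Ss es]]; first by exists 1; rewrite ?rpred1.
  have [t [n [St tn]]] := lam_surj (phi x).
  exists (s * t) => [|y]; first exact: rpredM.
  rewrite inE scalM => /predU1P[->|/es[m sm]].
    by exists (s *: n); rewrite -scalerA tn loc_linearZ.
  by exists (t *: m); rewrite mulrC -scalerA sm loc_linearZ.
exists s => // x; apply: (span_min (fun x => exists y, scal s *: phi x = lam y)
  _ _ _ (eP x)) => //.
split=> [|a y z [m ym] [n zn]].
  by exists 0; rewrite !loc_linear0 // scaler0.
exists (a *: m + n); rewrite lamL phiL -ym -zn scalerDr !scalerA.
by congr (_ *: _ + _); rewrite mulrC.
Qed.

(** Hom commutes with localization: over a noetherian ring [Hom (M, S^-1 N)] is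
    [S^-1 Hom (M, N)], of which this is the surjectivity. Choosing numerators
    of [s phi x] in [N] gives a map which is linear up to torsion, and
    multiplying it by a bound of the torsion makes it linear. *)
Lemma hom_lift M N Q (lam : N -> Q) (phi : M -> Q) :
  fin_gen M -> fin_gen N -> localizing lam -> loc_linear phi ->
  exists2 s, s \in S & exists psi : {linear M -> N},
    forall x, scal s *: phi x = lam (psi x).
Proof.
move=> fgM fgN lam_loc phiL; have [lamL _ _] := lam_loc.
have [s Ss /choice[h hE]] := common_denominator fgM lam_loc phiL.
have [u Su u_tor] := localizing_torsion_bound fgN lam_loc.
have psiL : linear (fun x => u *: h x).
  move=> a x y; apply/eqP; rewrite scalerA mulrC -scalerA -subr_eq0.
  rewrite -scalerDr -scalerBr; apply/eqP/u_tor.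
  rewrite loc_linearB // lamL -!hE phiL scalerDr !scalerA.
  by rewrite [scal s * _]mulrC subrr.
exists (u * s); first exact: rpredM.
by exists (to_linear psiL) => x; rewrite scalM -scalerA hE -loc_linearZ.
Qed.

End HomLift.

End Localization.

(** * From local to global *)

(** Zorn's lemma on the proper ideals containing [I]; the union of a nonempty
    chain is proper because it omits [1], and [I] itself bounds the empty
    chain. *)
Lemma ideal_in_max (R : comPzRingType) (I : {pred R}) :
  ideal I -> 1 \notin I -> exists m : maxspec R, {subset I <= m}.
Proof.
move=> idI I1.
pose T := {J : R -> bool | [/\ ideal J, 1 \notin J & {subset I <= J}]}.
pose t0 : T := exist _ I (And3 idI I1 (fun x => id)).
pose le : rel T := fun J K => `[< {subset sval J <= sval K} >].
have [J maxJ] : exists J : T, premaximal le J.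
  apply: (ZL_preorder t0 (R := le)) => [J|K J L /asboolP JK /asboolP KL|A totA].
  - exact/asboolP.
  - by apply/asboolP => x /JK /KL.
  have [[J0 AJ0]|A0] := pselect (exists J, A J); last first.
    by exists t0 => J AJ; case: A0; exists J.
  pose U : {pred R} := fun x => `[< exists2 J, A J & x \in sval J >].
  have UP x : reflect (exists2 J, A J & x \in sval J) (x \in U).
    exact: asboolP.
  have idU : ideal U.
    split=> [|a x y /UP[J AJ Jx] /UP[K AK Ky]]; apply/UP.
      by exists J0 => //; case: (svalP J0) => -[].
    have [/asboolP JK|/asboolP KJ] := totA _ _ AJ AK.
      by exists K => //; case: (svalP K) => -[_ + _ _]; apply => //; apply: JK.
    by exists J => //; case: (svalP J) => -[_ + _ _]; apply => //; apply: KJ.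
  have U1 : 1 \notin U.
    by apply/UP => -[J _]; case: (svalP J) => _ /negPf->.
  have IU : {subset I <= U}.
    by move=> x Ix; apply/UP; exists J0 => //; case: (svalP J0) => _ _; apply.
  exists (exist _ U (And3 idU U1 IU)) => J AJ.
  by apply/asboolP => x Jx; apply/UP; exists J.
have [idJ J1 IJ] := svalP J.
have J_max K : ideal K -> 1 \notin K -> {subset sval J <= K} ->
    {subset K <= sval J}.
  move=> idK K1 JK; have IK : {subset I <= K} by move=> x /IJ /JK.
  exact/asboolP/(maxJ (exist _ K (And3 idK K1 IK)))/asboolP.
by exists (MaxSpec idJ J1 J_max).
Qed.

Section LocalGlobal.
Variables (R : comPzRingType) (noethR : noetherian R) (X : subcat R).
Hypotheses (addX : additive_subcat X) (sumX : summand_closed X).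

Definition factors_through (M : lmodType R) (r : R) : Prop :=
  exists2 C : fgmod R, X C &
    exists g : {linear M -> C}, exists f : {linear C -> M},
      forall x, f (g x) = r *: x.

Lemma factors_through0 (M : lmodType R) : factors_through M 0.
Proof.
exists (FGMod (fin_gen_row R 0)).
  by apply: addX.1 => z; apply: thinmx0.
have zL (N P : lmodType R) : linear (fun _ : N => 0 : P).
  by move=> a x y; rewrite scaler0 addr0.
exists (to_linear (@zL M _)), (to_linear (@zL _ M)) => x.
by rewrite scale0r.
Qed.

(** The two factorizations are put side by side through the direct sum. *)
Lemma factors_throughD (M : lmodType R) a r q :
  factors_through M r -> factors_through M q -> factors_through M (a * r + q).
Proof.
move=> [C XC [g [f fg]]] [D XD [k [h hk]]].
have fgCD := fin_gen_prod (fgmod_fin_gen C) (fgmod_fin_gen D).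
exists (FGMod fgCD).
  exact: (addX.2 C D (FGMod fgCD) (lmod_iso_refl (C * D)%type)).
have gL : linear (fun x => (g x, k x) : (C * D)%type).
  by move=> b x y; rewrite !linearP.
have fL : linear (fun z : (C * D)%type => a *: f z.1 + h z.2).
  move=> b x y; rewrite /= 3!linearP /= scalerDr addrACA.
  by congr (_ + _); rewrite !scalerDr !scalerA mulrC.
exists (to_linear gL), (to_linear fL) => x /=.
by rewrite fg hk scalerDl scalerA.
Qed.

(** The complement of the retract [M] in [C] is the kernel of [f], through the
    splitting of [x] as [g (f x)] and [x - g (f x)]. *)
Lemma retract_mem (M C : fgmod R) (g : {linear M -> C}) (f : {linear C -> M}) :
  cancel g f -> X C -> X M.
Proof.
move=> gK; have kP x : x - g (f x) \in ker_pred f.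
  by apply/ker_predP; rewrite linearB gK subrr.
have fgK : fin_gen (kernel f).
  apply: (noetherian_inj_fin_gen noethR (i := ker_incl f)).
    exact: (ker_inclP f).1.
  exact: fgmod_fin_gen.
apply: (sumX (N := FGMod fgK)).
have hL : linear
    (fun x => (f x, Sub (x - g (f x)) (kP x)) : (M * kernel f)%type).
  move=> a x y; congr (_, _); first exact: linearP.
  by apply: val_inj; rewrite /= (linearP f) (linearP g) scalerBr opprD addrACA.
exists (to_linear hL); exists (fun z => g z.1 + val z.2) => [x|[m [k kk]]] /=.
  by rewrite addrC subrK.
have fk := ker_predP f k kk.
congr (_, _); [|apply: val_inj => /=]; rewrite linearD fk gK addr0 //.
by rewrite addrC addKr.
Qed.

(** The localized isomorphism between [M] and some [C] in [X] and its inverse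
    lift to maps [g] and [f] between [M] and [C], each up to a scalar outside
    [p]; the composite [f g] is then a homothety up to torsion, and exactly one
    after multiplication by a bound of the torsion. *)
Lemma local_factor (p : spec R) (M : fgmod R) :
  subcat_loc X p (fg_loc p M) ->
  exists2 r, r \notin spec_pred p & factors_through M r.
Proof.
move=> [C XC /loc_isoP[lam lam_loc]]; have [lamL _ _] := lam_loc.
have iotaM := @iota_localizing _ (spec_compl p) M.
have [iotaL _ _] := iotaM.
have fgC := fgmod_fin_gen C; have fgM := fgmod_fin_gen M.
have [s Ss [g gE]] := hom_lift noethR fgM fgC lam_loc iotaL.
have [t St [f fE]] := hom_lift noethR fgC fgM iotaM lamL.
have [u Su u_tor] := localizing_torsion_bound noethR fgM iotaM.
exists (u * (t * s)); first by do 2?[apply: (rpredM (s := spec_compl p))].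
have ufL : linear (fun x => u *: f x).
  by move=> a x y; rewrite linearP scalerDr !scalerA mulrC.
exists C => //; exists g, (to_linear ufL) => x /=.
apply/eqP; rewrite -scalerA -subr_eq0 -scalerBr; apply/eqP/u_tor.
by rewrite loc_linearB // -fE -gE loc_linearZ // scalerA -scalM subrr.
Qed.

(** The [r] whose homothety on [M] factors through [X] form an ideal which, by
    [local_factor], lies in no maximal ideal. So it contains [1], and then [M]
    is a direct summand of an object of [X]. *)
Lemma local_global (M : fgmod R) :
  (forall m : maxspec R,
    subcat_loc X (spec_of_max m) (fg_loc (spec_of_max m) M)) -> X M.
Proof.
move=> XM; pose I : {pred R} := fun r => `[< factors_through M r >].
have idI : ideal I.
  split=> [|a r q /asboolP Ir /asboolP Iq]; apply/asboolP.
    exact: factors_through0.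
  exact: factors_throughD.
have [/asboolP[C XC [g [f fg]]]|I1] := boolP (1 \in I).
  by apply: (retract_mem (g := g) (f := f) _ XC) => x; rewrite fg scale1r.
have [m Im] := ideal_in_max idI I1.
have [r /negP rm r_fact] := local_factor (XM m).
by case: rm; apply: Im; apply/asboolP.
Qed.

Lemma subcat_loc_fg_loc (p : spec R) (M : fgmod R) :
  X M -> subcat_loc X p (fg_loc p M).
Proof. by exists M => //; apply: lmod_iso_refl. Qed.

Lemma ext_closed_of_max :
  (forall m : maxspec R, ext_closed (subcat_loc X (spec_of_max m))) ->
  ext_closed X.
Proof.
move=> extX L M N f g [f_inj fg g_surj] XL XN; apply: local_global => m.
set p := spec_of_max m.
have [F FE] := loc_map (spec_compl p) f.
have [G GE] := loc_map (spec_compl p) g.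
apply: (extX m (fg_loc p L) (fg_loc p M) (fg_loc p N) F G);
  try exact: subcat_loc_fg_loc.
split; first exact: loc_map_inj FE f_inj.
  exact: loc_map_exact FE GE fg.
exact: loc_map_surj GE g_surj.
Qed.

Lemma ker_closed_of_max :
  (forall m : maxspec R, ker_closed (subcat_loc X (spec_of_max m))) ->
  ker_closed X.
Proof.
move=> kerX M N f XM XN K i [i_inj ker_i]; apply: local_global => m.
set p := spec_of_max m.
have [F FE] := loc_map (spec_compl p) f.
have [I IE] := loc_map (spec_compl p) i.
apply: (kerX m (fg_loc p M) (fg_loc p N) F _ _ (fg_loc p K) I);
  try exact: subcat_loc_fg_loc.
by split; [exact: loc_map_inj IE i_inj | exact: loc_map_exact IE FE ker_i].
Qed.

End LocalGlobal.

(** * From global to local *)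

Section Descent.
Variables (R : comPzRingType) (noethR : noetherian R) (X : subcat R).
Variable p : spec R.

(** Up to a unit a morphism [f'] between localizations comes from a morphism
    [f] over [R] ([hom_lift]), and the kernel of [f'] is the localization of
    the kernel of [f]. *)
Lemma ker_closed_loc : ker_closed X -> ker_closed (subcat_loc X p).
Proof.
move=> kerX M' N' f' [M XM /loc_isoP[lM lM_loc]] [N XN /loc_isoP[lN lN_loc]].
move=> K' i' [i'_inj ker_i']; have [lML lM0 lM_surj] := lM_loc.
have [lNL lN0 _] := lN_loc.
have fgM := fgmod_fin_gen M; have fgN := fgmod_fin_gen N.
have [s Ss [f fE]] := hom_lift noethR fgM fgN lN_loc (loc_linear_comp lML f').
have fgK : fin_gen (kernel f).
  exact: noetherian_inj_fin_gen noethR _ _ _ (ker_inclP f).1 fgM.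
exists (FGMod fgK); first exact: kerX XM XN (FGMod fgK) _ (ker_inclP f).
apply/loc_isoP.
have /choice[lK lKE] (k : kernel f) : exists x, i' x = lM (ker_incl f k).
  apply/ker_i'/(scal_inj Ss); rewrite /= fE scaler0.
  by rewrite ((ker_inclP f).2 _).2 ?(loc_linear0 lNL); last exists k.
exists lK; split=> [a x y|x|y].
- by apply: i'_inj; rewrite lKE linearP lML linearP !lKE.
- split=> [lx|[u Su ux]].
    have /lM0[u Su ux] : lM (ker_incl f x) = 0 by rewrite -lKE lx linear0.
    exists u => //; apply: (ker_inclP f).1.
    by rewrite [RHS]linear0 linearZ /= ux.
  apply: i'_inj; rewrite lKE linear0; apply/lM0; exists u => //.
  by rewrite -[LHS](linearZ_LR (ker_incl f)) ux linear0.
have [t [m [St tm]]] := lM_surj (i' y).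
have /lN0[u Su ufm] : lN (f m) = 0.
  rewrite -fE -tm linearZ /= ((ker_i' _).2 _) ?scaler0 //.
  by exists y.
have [|k km] := ((ker_inclP f).2 (u *: m)).1; first by rewrite linearZ.
exists (u * t), k; split; first exact: (rpredM (s := spec_compl p)).
apply: i'_inj; rewrite lKE km (loc_linearZ lML) -tm scalM -scalerA.
by rewrite 2!(linearZ_LR i').
Qed.

(** Projectivity of free modules, across the change of rings from [R] to its
    localization: the images of the basis vectors under [chi] are lifted along
    [g]. *)
Lemma free_lift (S : mulrClosed R) (M N : lmodType (locr S))
    (g : {linear M -> N}) k (chi : 'rV[R]_k -> N) :
  (forall z, exists y, g y = z) -> loc_linear chi ->
  exists2 sigma : 'rV[R]_k -> M, loc_linear sigma &
    forall v, g (sigma v) = chi v.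
Proof.
move=> g_surj chiL.
have /choice[y yE] i : exists y, g y = chi (delta_mx 0 i) by exact: g_surj.
exists (fun v => \sum_i scal S (v 0 i) *: y i) => [a v w|v].
  rewrite scaler_sumr -big_split; apply: eq_bigr => i _ /=.
  by rewrite !mxE scalerA -scalM -scalerDl scalD.
rewrite [in RHS](row_sum_delta v) linear_sum.
rewrite (big_morph chi (loc_linearD chiL) (loc_linear0 chiL)).
by apply: eq_bigr => i _; rewrite linearZ /= yE (loc_linearZ chiL).
Qed.

Lemma free_cover (N : lmodType R) : fin_gen N ->
  exists k, exists pi : {linear 'rV[R]_k -> N}, forall n, exists v, pi v = n.
Proof.
move=> [k [g gP]]; exists k.
have piL : linear (fun v : 'rV[R]_k => \sum_i v 0 i *: g i).
  move=> a v w; rewrite scaler_sumr -big_split; apply: eq_bigr => i _ /=.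
  by rewrite !mxE scalerDl scalerA.
exists (to_linear piL) => n; have [c ->] := gP n; exists (\row_i c i).
by apply: eq_bigr => i _; rewrite mxE.
Qed.

(** The pushout of [0 -> kernel pi -> V -> N -> 0] along [psi]. The middle term
    is presented as the quotient of [L * V] by the elements [(psi z, - z)]: this
    is the form in which its localization is computed. *)
Lemma pushout_extension (L V N : lmodType R) (pi : {linear V -> N})
    (psi : {linear kernel pi -> L}) :
  fin_gen L -> fin_gen V -> (forall n, exists v, pi v = n) ->
  exists (M : fgmod R) (q : {linear (L * V)%type -> M})
         (i : {linear L -> M}) (g : {linear M -> N}),
    [/\ short_exact i g, forall m, exists x, q x = m
      & forall x y, q x = q y <-> exists z, (psi z, - ker_incl pi z) = x - y].
Proof.
move=> fgL fgV pi_surj.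
set j : {linear kernel pi -> V} := ker_incl pi.
have [j_inj jP] : is_kernel j pi := ker_inclP pi.
have hL : linear (fun z : kernel pi => (psi z, - j z) : (L * V)%type).
  move=> a x y; congr (_, _); first exact: linearP.
  by rewrite (linearP j) opprD -scalerN.
pose h := to_linear hL; pose q := coker_proj h.
have qP x y : q x = q y <-> exists z, (psi z, - j z) = x - y.
  exact: coker_projP.
have q_surj : forall m, exists x, q x = m := @coker_proj_surj _ _ _ h.
have iL : linear (fun l : L => q (l, 0)).
  move=> a x y; rewrite -linearP; congr (q _).
  by congr (_, _); rewrite /= scaler0 addr0.
have [x y /qP[z] /(congr1 snd) /= e|g gE] :=
    factor_surj (k := fun x : L * V => pi x.2) q_surj.
  apply/eqP; rewrite -subr_eq0 -linearB -e linearN oppr_eq0.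
  by apply/eqP/jP; exists z.
have gL : linear g.
  move=> a m m'; have [[x <-] [y <-]] := (q_surj m, q_surj m').
  by rewrite -linearP !gE linearP.
exists (FGMod (fin_gen_image q_surj (fin_gen_prod fgL fgV))), q.
exists (to_linear iL), (to_linear gL); split=> //.
split=> [l l' /qP[z [e1 e2]]|m|n].
- have z0 : z = 0.
    by apply: j_inj; rewrite linear0; apply: oppr_inj; rewrite e2 subrr oppr0.
  by apply/eqP; rewrite -subr_eq0 -e1 z0 linear0.
- have [[l v] <-] := q_surj m; rewrite /= gE; split.
    move/jP=> [z jz]; exists (l + psi z); apply/qP; exists z.
    by rewrite jz; congr (_, _) => /=; rewrite ?sub0r // addrC addKr.
  move=> [l' /qP[z [_ e]]]; apply/jP; exists z.
  by apply: oppr_inj; rewrite e sub0r.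
- by have [v <-] := pi_surj n; exists (q (0, v)); rewrite /= gE.
Qed.

(** This is the surjectivity of [Ext^1_R (N, L) -> Ext^1_{R_p} (N_p, L_p)] up to
    units. Cover [N] by a free module [V] with kernel [K]. Lifting [V -> N'] to
    [M'] and restricting to [K] gives the map [phi : K -> L'] that classifies
    the given extension. Some multiple [s phi] comes from a map [psi : K -> L];
    the pushout [M] along [psi] lies in [X], and as [s] is a unit in [R_p], the
    extension [M'] is the localization of [M], by the map that is [f'] on [L]
    and [s sigma] on [V]. *)
Lemma ext_closed_loc : ext_closed X -> ext_closed (subcat_loc X p).
Proof.
move=> extX L' M' N' f' g' [f'_inj ker_g' g'_surj].
move=> [L XL /loc_isoP[lL lL_loc]] [N XN /loc_isoP[lN lN_loc]].
have [lLL lL0 lL_surj] := lL_loc; have [lNL lN0 lN_surj] := lN_loc.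
have fgL := fgmod_fin_gen L; have fgV := fin_gen_row R.
have [k [pi pi_surj]] := free_cover (fgmod_fin_gen N).
have [sigma sigmaL sigmaE] := free_lift g'_surj (loc_linear_precomp lNL pi).
set j := ker_incl pi; have [j_inj jP] : is_kernel j pi := ker_inclP pi.
have fgK : fin_gen (kernel pi).
  exact: noetherian_inj_fin_gen noethR _ _ _ j_inj (fgV k).
have /choice[phi phiE] (z : kernel pi) : exists y, f' y = sigma (j z).
  apply/ker_g'; rewrite sigmaE (jP _).2 ?(loc_linear0 lNL) //.
  by exists z.
have phiL : loc_linear phi.
  by move=> a x y; apply: f'_inj; rewrite phiE linearP sigmaL linearP !phiE.
have [s Ss [psi psiE]] := hom_lift noethR fgK fgL lL_loc phiL.
have [M [q [i [g [ig_exact q_surj qP]]]]] :=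
  pushout_extension psi fgL (fgV k) pi_surj.
exists M; first exact: extX ig_exact XL XN.
apply/loc_isoP.
pose Phi (x : L * 'rV[R]_k) := f' (lL x.1) + scal _ s *: sigma x.2.
have PhiL : loc_linear Phi.
  move=> a x y; rewrite /Phi /= lLL sigmaL linearP !scalerDr !scalerA.
  by rewrite addrACA [scal _ s * _]mulrC.
have [x y /qP[z e]|lM lME] := factor_surj (k := Phi) q_surj.
  apply/eqP; rewrite -subr_eq0 -(loc_linearB PhiL) -e /Phi /= -psiE.
  by rewrite (loc_linearN sigmaL) linearZ /= phiE scalerN subrr.
have lMf l : lM (q (l, 0)) = f' (lL l).
  by rewrite lME /Phi /= (loc_linear0 sigmaL) scaler0 addr0.
have g'lM l v : g' (lM (q (l, v))) = scal _ s *: lN (pi v).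
  rewrite lME /Phi linearD linearZ /= sigmaE (ker_g' _).2 ?add0r //.
  by exists (lL l).
exists lM; split.
- move=> a m m'; have [[x <-] [y <-]] := (q_surj m, q_surj m').
  by rewrite -linearP !lME PhiL.
- move=> m; have [[l v] <-] := q_surj m; split=> [lx|[u Su ux]]; last first.
    apply: (scal_inj Su); rewrite /= scaler0 lME -(loc_linearZ PhiL) -lME.
    by rewrite linearZ /= ux -(linear0 q) lME (loc_linear0 PhiL).
  have /lN0[u Su uv] : lN (pi v) = 0.
    by apply: (scal_inj Ss); rewrite /= -(g'lM l) lx linear0 scaler0.
  have [|z jz] := (jP (u *: v)).1; first by rewrite linearZ.
  have quv : q (u *: (l, v)) = q (u *: l + psi z, 0).
    apply/esym/qP; exists z; rewrite -/j jz.
    by congr (_, _) => /=; rewrite ?sub0r // addrC addKr.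
  have /lL0[t St tl] : lL (u *: l + psi z) = 0.
    apply: f'_inj; rewrite linear0 -lMf -quv lME (loc_linearZ PhiL) -lME lx.
    exact: scaler0.
  exists (t * u); first exact: (rpredM (s := spec_compl p)).
  rewrite -scalerA -[u *: q _](linearZ_LR q) quv -[LHS](linearZ_LR q).
  by rewrite -(linear0 q); congr (q (_, _)); rewrite // scaler0.
- move=> y; have [t [n [St tn]]] := lN_surj (g' y); have [v vn] := pi_surj n.
  have [|l' l'E] := (ker_g' (scal _ t *: y - sigma v)).1.
    by rewrite linearB linearZ /= tn sigmaE vn subrr.
  have [r [l [Sr rl]]] := lL_surj l'.
  (* t y - sigma v is in the image of f', and r clears its denominator; the
     common factor s makes the lift v fit the factor s in Phi *)
  exists (s * r * t), (q (s *: l, r *: v)).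
  split; first by do 2?[apply: (rpredM (s := spec_compl p))].
  rewrite lME /Phi /= (loc_linearZ lLL) (loc_linearZ sigmaL) -rl.
  rewrite !linearZ /= l'E.
  rewrite !scalM -!scalerA [X in _ + X]scalerA [scal _ r * scal _ s]mulrC.
  by rewrite -[X in _ + X]scalerA -!scalerDr subrK.
Qed.

End Descent.

Theorem corollary3p5 (R : comPzRingType) (noethR : noetherian R)
    (X : subcat R) (addX : additive_subcat X) (sumX : summand_closed X) :
  [/\ [<-> ext_closed X;
           forall p : spec R, ext_closed (subcat_loc X p);
           forall m : maxspec R, ext_closed (subcat_loc X (spec_of_max m))],
      [<-> ker_closed X;
           forall p : spec R, ker_closed (subcat_loc X p);
           forall m : maxspec R, ker_closed (subcat_loc X (spec_of_max m))]
    & [<-> ke_closed X;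
           forall p : spec R, ke_closed (subcat_loc X p);
           forall m : maxspec R, ke_closed (subcat_loc X (spec_of_max m))]].
Proof.
have ext_max := ext_closed_of_max noethR addX sumX.
have ker_max := ker_closed_of_max noethR addX sumX.
split; tfae=> //.
- by move=> extX p; apply: ext_closed_loc.
- by move=> kerX p; apply: ker_closed_loc.
- move=> [extX kerX] p.
  by split; [apply: ext_closed_loc | apply: ker_closed_loc].
- move=> keX; split; [apply: ext_max | apply: ker_max] => m.
    exact: (keX m).1.
  exact: (keX m).2.
Qed.
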